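(* Let $\mathbb{K}$ be a field, let $f\in\mathbb{K}(x)$, and let $u_1,u_2$ be two units in $\mathbb{K}(x)$ such that $g=u_1\circ f\circ u_2$ is in normal form. Let $\mathbb{F}$ be the splitting field over $\mathbb{K}$ of $\{g_N,g_D\}$. Then for any field $\mathbb{K}'\supset\mathbb{K}$, any decomposition of $f$ in $\mathbb{K}'(x)$ is equivalent to a decomposition of $f$ in $\mathbb{F}(x)$.
   Context: For $f\in\mathbb{K}(x)$ write $f=f_N/f_D$ with $f_N,f_D\in\mathbb{K}[x]$ coprime. The function $f$ is in normal form if $\deg f_N>\deg f_D$ and $f_N(0)=0$ (thus $f_D(0)\neq0$, and $f$ is non-constant). The units of $\mathbb{K}(x)$ with respect to composition are the Möbius transformations $(ax+b)/(cx+d)$ with $a,b,c,d\in\mathbb{K}$, $ad-bc\ne0$. A decomposition of $f$ in $L(x)$, for a field $L\supseteq\mathbb{K}$, is an expression $f=p\circ h$ with $p,h\in L(x)$. Two decompositions $f=p_1\circ h_1=p_2\circ h_2$ are equivalent if there is a unit $u$ with $h_1=u\circ h_2$ and $p_1=p_2\circ u^{-1}$ (inverse with respect to composition). When the decompositions have coefficients in different extensions $\mathbb{K}'$ and $\mathbb{F}$ of $\mathbb{K}$, both fields are regarded inside a common extension field and $u$ is a unit with coefficients in that common extension. *)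

(* Defs.v *)
From HB Require Import structures.
From mathcomp Require Import all_boot all_order all_algebra all_field.
Set Implicit Arguments.
Unset Strict Implicit.
Unset Printing Implicit Defensive.
Import GRing.Theory.
Local Open Scope ring_scope.

(* The field K(x) of rational functions. *)
Notation ratfun K := {fraction {poly K}}.
Notation "p %:F" := (@FracField.tofrac _ p) : ring_scope.

Lemma eq_div_cross (L : fieldType) (a b c d f : L) :
  b != 0 -> d != 0 -> f = a / b -> f = c / d -> a * d = c * b.
Proof. by move=> b0 d0 -> /eqP; rewrite eqr_div // => /eqP. Qed.

Lemma div_scale (L : fieldType) (c a b : L) :
  c != 0 -> (c * a) / (c * b) = a / b.
Proof. by move=> c0; rewrite -mulf_div divff // mul1r. Qed.

Section RatFun.
Variable K : fieldType.
Implicit Types f : ratfun K.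

(* [repr f] is an arbitrary, possibly non-reduced, representative of f. *)
Definition rf_num f : {poly K} :=
  \n_(repr f) %/ gcdp \n_(repr f) \d_(repr f).
Definition rf_den f : {poly K} :=
  \d_(repr f) %/ gcdp \n_(repr f) \d_(repr f).

Definition rf_X : ratfun K := ('X)%:F.

Definition rf_eval (p : {poly K}) (h : ratfun K) : ratfun K :=
  (map_poly (fun c : K => (c%:P)%:F) p).[h].

(* The composition p(h).  Since x / 0 = 0 in the field K(x), it is 0 when h is a
   constant at which p has a pole, the only case in which p(h) is undefined.
   That value is constant, so it is never a function in normal form. *)
Definition rf_comp (p h : ratfun K) : ratfun K :=
  rf_eval (rf_num p) h / rf_eval (rf_den p) h.

Definition normal_form f : Prop :=
  (size (rf_den f) < size (rf_num f))%N /\ (rf_num f).[0] = 0.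

Definition is_unit (u : ratfun K) : Prop :=
  exists a b c d : K, a * d - b * c != 0 /\
    u = (a *: 'X + b%:P)%:F / (c *: 'X + d%:P)%:F.

Definition comp_inverse (u v : ratfun K) : Prop :=
  rf_comp u v = rf_X /\ rf_comp v u = rf_X.

Definition decomposition f (p h : ratfun K) : Prop := f = rf_comp p h.

Definition equiv_decomp (p1 h1 p2 h2 : ratfun K) : Prop :=
  exists u v : ratfun K,
    [/\ is_unit u, comp_inverse u v, h1 = rf_comp u h2 & p1 = rf_comp p2 v].

Lemma rf_gcd_neq0 f : gcdp \n_(repr f) \d_(repr f) != 0.
Proof. by rewrite gcdp_eq0 negb_and orbC denom_ratioP. Qed.

Lemma rf_den_neq0 f : rf_den f != 0.
Proof.
by rewrite /rf_den dvdp_div_eq0 ?dvdp_gcdr // denom_ratioP.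
Qed.

Lemma rf_coprime f : coprimep (rf_num f) (rf_den f).
Proof. by apply: coprimep_div_gcd; rewrite denom_ratioP orbT. Qed.

Lemma ratfunE f : f = (rf_num f)%:F / (rf_den f)%:F.
Proof.
have d0 : (rf_den f)%:F != 0 :> ratfun K by rewrite tofrac_eq0 rf_den_neq0.
apply: (canRL (mulfK d0)).
have g0 : (gcdp \n_(repr f) \d_(repr f))%:F != 0 :> ratfun K.
  by rewrite tofrac_eq0 rf_gcd_neq0.
apply: (mulIf g0); rewrite -mulrA -!tofracM.
rewrite /rf_num /rf_den !divpK ?dvdp_gcdl ?dvdp_gcdr //.
rewrite -{1}[f]reprK; move: (repr f) => r.
unlock FracField.tofrac.
rewrite !piE; apply/eqmodP.
rewrite /= FracField.equivfE /FracField.mulf.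
by rewrite !numden_Ratio ?mulr1 ?oner_neq0 ?denom_ratioP // mulrC.
Qed.

Lemma ratfun_ratioE f (n d : {poly K}) : d != 0 -> f = n%:F / d%:F ->
  exists2 c, c != 0 & n = c * rf_num f /\ d = c * rf_den f.
Proof.
move=> dn0 fE; have D0 : rf_den f != 0 := rf_den_neq0 f.
have E : n * rf_den f = rf_num f * d.
  apply/eqP; rewrite -tofrac_eq !tofracM; apply/eqP.
  have d1 : d%:F != 0 :> ratfun K by rewrite tofrac_eq0.
  have d2 : (rf_den f)%:F != 0 :> ratfun K by rewrite tofrac_eq0.
  exact: (eq_div_cross d1 d2 fE (ratfunE f)).
have /dvdpP [c dE] : rf_den f %| d.
  have cop : coprimep (rf_den f) (rf_num f) by rewrite coprimep_sym rf_coprime.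
  by rewrite -(Gauss_dvdpr d cop) -E dvdp_mull.
exists c; first by apply: contraNneq dn0 => c0; rewrite dE c0 mul0r.
split=> //; by apply: (mulIf D0); rewrite E dE mulrCA mulrA.
Qed.

Lemma rf_evalM (p q : {poly K}) h :
  rf_eval (p * q) h = rf_eval p h * rf_eval q h.
Proof.
pose i : {rmorphism K -> ratfun K} := (@FracField.tofrac _) \o (@polyC K).
by rewrite /rf_eval (rmorphM (map_poly i)) hornerM.
Qed.

Lemma rf_comp_fracE (n d : {poly K}) h : rf_eval d h != 0 ->
  rf_comp (n%:F / d%:F) h = rf_eval n h / rf_eval d h.
Proof.
move=> dh; have dn0 : d != 0.
  by apply: contraNneq dh => ->; rewrite /rf_eval map_poly0 horner0.
move E: (n%:F / d%:F) => f; have [c _ [nE dE]] := ratfun_ratioE dn0 (esym E).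
move: dh; rewrite /rf_comp nE dE !rf_evalM mulf_eq0 negb_or => /andP[c0 d0].
exact: esym (div_scale _ _ c0).
Qed.

End RatFun.

Definition rf_map (K L : fieldType) (i : {rmorphism K -> L}) (f : ratfun K) :
  ratfun L := (map_poly i (rf_num f))%:F / (map_poly i (rf_den f))%:F.

Lemma rf_map_fracE (K L : fieldType) (i : {rmorphism K -> L})
    (n d : {poly K}) : d != 0 ->
  rf_map i (n%:F / d%:F) = (map_poly i n)%:F / (map_poly i d)%:F.
Proof.
move=> dn0; move E: (n%:F / d%:F) => f.
have [c c0 [nE dE]] := ratfun_ratioE dn0 (esym E).
rewrite /rf_map nE dE !rmorphM /=.
by apply: esym; apply: div_scale; rewrite tofrac_eq0 map_poly_eq0.
Qed.

Definition splitting_field2 (K : fieldType) (F : fieldExtType K)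
    (p q : {poly K}) : Prop :=
  exists rp rq : seq F,
    [/\ map_poly (in_alg F) p %= \prod_(z <- rp) ('X - z%:P),
        map_poly (in_alg F) q %= \prod_(z <- rq) ('X - z%:P) &
        <<1 & rp ++ rq>>%VS = fullv].

(* Main.v *)
Require Import Defs.
From HB Require Import structures.
From mathcomp Require Import all_boot all_order all_algebra all_field.
From mathcomp Require Import ring.
Set Implicit Arguments.
Unset Strict Implicit.
Unset Printing Implicit Defensive.
Import GRing.Theory.
Local Open Scope ring_scope.

(* Write g = P o H over Omega, with P = u1 o p and H = h o u2.  As g fixes 0 and
   infinity, H takes distinct values there, so a unit w makes w o H = A / B
   normal.  Then A divides g_N and B divides g_D, hence both are, up to
   constants, products of linear factors of g_N and g_D, and lie in F[x].  So H
   is a unit composed with some H2 in F(x), and g = P2 o H2 for some P2 over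
   Omega.  The coefficients of such a P2 solve a homogeneous linear system over
   F, so P2 may be taken in F(x).  Undoing u1 and u2 gives the decomposition
   over F; the outer functions correspond because composition with a nonconstant
   function on the right is injective. *)

(** * Extending injective morphisms from polynomials to rational functions *)

Lemma subf_div (L : fieldType) (a b c d : L) : b != 0 -> d != 0 ->
  a / b - c / d = (a * d - c * b) / (b * d).
Proof. by move=> b0 d0; rewrite -mulNr addf_div // mulNr. Qed.

(** The reduced fraction serves as canonical representative; when [e] kills no nonzero polynomial,
    every other representative gives the same value, and this yields additivity and
    multiplicativity. *)
Definition frac_lift (K L : fieldType) (e : {rmorphism {poly K} -> L})
  (f : ratfun K) : L := e (rf_num f) / e (rf_den f).

Lemma frac_liftE (K L : fieldType) (e : {rmorphism {poly K} -> L})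
    (einj : forall n, n != 0 -> e n != 0) (n d : {poly K}) : d != 0 ->
  frac_lift e (n%:F / d%:F) = e n / e d.
Proof.
move=> dn0; move E: (n%:F / d%:F) => f.
have [c c0 [nE dE]] := ratfun_ratioE dn0 (esym E).
have ec : e c != 0 by apply: einj.
by rewrite /frac_lift nE dE !rmorphM /= div_scale.
Qed.

(** Serves twice: for extension of the base field and for composition with a fixed nonconstant inner
    function. *)
Lemma frac_lift_rmorphism (K L : fieldType) (e : {rmorphism {poly K} -> L})
    (einj : forall n, n != 0 -> e n != 0) :
  exists phi : {rmorphism ratfun K -> L}, forall f, phi f = frac_lift e f.
Proof.
have den0 (f : ratfun K) : (rf_den f)%:F != 0 :> ratfun K.
  by rewrite tofrac_eq0 rf_den_neq0.
have eden0 (f : ratfun K) : e (rf_den f) != 0 by exact/einj/rf_den_neq0.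
have liftB : GRing.zmod_morphism (frac_lift e).
  move=> f g; have -> : f - g = (rf_num f * rf_den g - rf_num g * rf_den f)%:F
                      / (rf_den f * rf_den g)%:F.
    rewrite {1}[f]ratfunE {1}[g]ratfunE.
    by rewrite subf_div // rmorphB !rmorphM.
  rewrite frac_liftE ?mulf_neq0 ?rf_den_neq0 // rmorphB !rmorphM /=.
  by rewrite /frac_lift subf_div.
have liftM : GRing.monoid_morphism (frac_lift e).
  split=> [|f g].
    have -> : 1 = 1%:F / 1%:F :> ratfun K by rewrite rmorph1 divr1.
    by rewrite frac_liftE ?oner_neq0 // rmorph1 divr1.
  have -> : f * g = (rf_num f * rf_num g)%:F / (rf_den f * rf_den g)%:F.
    by rewrite {1}[f]ratfunE {1}[g]ratfunE !rmorphM /= mulf_div.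
  by rewrite frac_liftE ?mulf_neq0 ?rf_den_neq0 // !rmorphM /= -mulf_div.
pose bA := GRing.isZmodMorphism.Build _ _ _ liftB.
pose bM := GRing.isMonoidMorphism.Build _ _ _ liftM.
pose phi : {rmorphism ratfun K -> L} := HB.pack (frac_lift e) bA bM.
by exists phi.
Qed.

Definition rf_const (K : fieldType) : {rmorphism K -> ratfun K} :=
  (@FracField.tofrac {poly K}) \o (@polyC K).

Lemma rf_map_morphism (K L : fieldType) (i : {rmorphism K -> L}) :
  exists phi : {rmorphism ratfun K -> ratfun L}, forall f, phi f = rf_map i f.
Proof.
pose e : {rmorphism {poly K} -> ratfun L} :=
  (@FracField.tofrac {poly L}) \o (map_poly i).
have einj n : n != 0 -> e n != 0 by rewrite /= tofrac_eq0 map_poly_eq0.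
by have [phi phiE] := frac_lift_rmorphism einj; exists phi.
Qed.

Definition eval_morph (K : fieldType) (h : ratfun K) :
    {rmorphism {poly K} -> ratfun K} :=
  horner_eval h \o map_poly (rf_const K).

Lemma rf_evalE (K : fieldType) (h : ratfun K) n :
  rf_eval n h = (map_poly (rf_const K) n).[h].
Proof. by []. Qed.

Lemma eval_morphE (K : fieldType) (h : ratfun K) n : eval_morph h n = rf_eval n h.
Proof. by []. Qed.

(** * Homogenization: the polynomial $B^k n(A/B)$ for [n] of degree at most [k] *)

Definition homog (K : fieldType) (k : nat) (n A B : {poly K}) : {poly K} :=
  \sum_(i < k.+1) n`_i *: (A ^+ i * B ^+ (k - i)).

Lemma homogS (K : fieldType) (k : nat) (n A B : {poly K}) :
  homog k.+1 n A B = n`_k.+1 *: A ^+ k.+1 + homog k n A B * B.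
Proof.
rewrite /homog big_ord_recr /= subnn expr0 mulr1 addrC; congr (_ + _).
rewrite mulr_suml; apply: eq_bigr => i _.
by rewrite -scalerAl -mulrA -exprSr subSn // -ltnS.
Qed.

(** Modulo [B] only the top term $n_k A^k$ survives, and it is coprime to [B]. *)
Lemma homog_coprime_den (K : fieldType) (k : nat) (n A B : {poly K}) :
  coprimep A B -> n`_k != 0 -> coprimep B (homog k n A B).
Proof.
move=> cAB nk; have cop : coprimep B (n`_k *: A ^+ k).
  by rewrite coprimepZr // coprimep_expr // coprimep_sym.
case: k nk cop => [|k] nk cop; last by rewrite homogS addrC coprimep_addl_mul.
by rewrite /homog big_ord1 subnn expr0 mulr1.
Qed.

Lemma homog_dvd_den (K : fieldType) (k : nat) (n A B : {poly K}) :
  n`_k = 0 -> B %| homog k n A B.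
Proof.
case: k => [|k] nk; first by rewrite /homog big_ord1 nk scale0r dvdp0.
by rewrite homogS nk scale0r add0r dvdp_mull.
Qed.

(** Mirror image of [homogS]: modulo [A] only the term of index 0 survives. *)
Lemma homog_lowE (K : fieldType) (k : nat) (n A B : {poly K}) :
  exists q, homog k n A B = q * A + n`_0 *: B ^+ k.
Proof.
rewrite /homog big_ord_recl /= expr0 mul1r subn0.
exists (\sum_(i < k) n`_(i.+1) *: (A ^+ i * B ^+ (k - i.+1))).
rewrite addrC mulr_suml; congr (_ + _); apply: eq_bigr => i _.
by rewrite -scalerAl mulrAC -exprSr.
Qed.

Lemma homog_coprime_num (K : fieldType) (k : nat) (n A B : {poly K}) :
  coprimep A B -> n`_0 != 0 -> coprimep A (homog k n A B).
Proof.
move=> cAB n0; have [q ->] := homog_lowE k n A B.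
by rewrite coprimep_addl_mul coprimepZr // coprimep_expr.
Qed.

Lemma homog_dvd_num (K : fieldType) (k : nat) (n A B : {poly K}) :
  n`_0 = 0 -> A %| homog k n A B.
Proof.
by move=> n0; have [q ->] := homog_lowE k n A B; rewrite n0 scale0r addr0 dvdp_mull.
Qed.

(** Replacing a factor [B] by [A] does not lower the degree, so no term exceeds $A^k$. *)
Lemma size_homog_leq (K : fieldType) (k : nat) (n A B : {poly K}) :
  (size B < size A)%N -> (size (homog k n A B) <= size (A ^+ k))%N.
Proof.
move=> AB; have A0 : A != 0 by rewrite -size_poly_gt0 (leq_trans _ AB).
elim: k => [|k IHk].
  rewrite /homog big_ord1 expr0 mul1r alg_polyC size_poly1.
  exact: size_polyC_leq1.
rewrite homogS (leq_trans (size_polyD _ _)) // geq_max size_scale_leq /=.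
have [-> | H0] := eqVneq (homog k n A B) 0; first by rewrite mul0r size_poly0.
have [-> | B0] := eqVneq B 0; first by rewrite mulr0 size_poly0.
rewrite exprSr !size_mul ?expf_neq0 //.
by rewrite -!subn1 leq_sub2r // leq_add // ltnW.
Qed.

(** Every term other than the top one contains a factor [B], hence has degree below that of $A^k$
    and cannot cancel it. *)
Lemma size_homog (K : fieldType) (k : nat) (n A B : {poly K}) :
  (size B < size A)%N -> n`_k != 0 -> size (homog k n A B) = size (A ^+ k).
Proof.
move=> AB nk; have A0 : A != 0 by rewrite -size_poly_gt0 (leq_trans _ AB).
case: k nk => [|k] nk.
  by rewrite /homog big_ord1 !expr0 mul1r alg_polyC size_poly1 size_polyC nk.
rewrite homogS size_polyDl ?size_scale //.
have [-> | H0] := eqVneq (homog k n A B) 0.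
  by rewrite mul0r size_poly0 size_poly_gt0 expf_neq0.
have [-> | B0] := eqVneq B 0.
  by rewrite mulr0 size_poly0 size_poly_gt0 expf_neq0.
have le := size_homog_leq k n AB.
rewrite exprSr !size_mul ?expf_neq0 //.
rewrite ltn_predRL prednK ?addn_gt0 ?size_poly_gt0 ?H0 //.
by rewrite -addnS leq_add.
Qed.

Lemma rf_eval_homog (K : fieldType) (k : nat) (n A B : {poly K}) :
  B != 0 -> (size n <= k.+1)%N ->
  rf_eval n (A%:F / B%:F) * B%:F ^+ k = (homog k n A B)%:F.
Proof.
move=> B0 nk; have BF : B%:F != 0 :> ratfun K by rewrite tofrac_eq0.
rewrite /rf_eval (@horner_coef_wide _ k.+1) ?(leq_trans (size_poly _ _)) //.
rewrite mulr_suml rmorph_sum /=; apply: eq_bigr => i _.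
rewrite coef_map_id0 // -mul_polyC !rmorphM !rmorphXn /= -mulrA; congr (_ * _).
rewrite expr_div_n -mulrA; congr (_ * _).
apply: (canLR (mulKf _)); first by rewrite expf_neq0.
by rewrite -exprD subnKC // -ltnS.
Qed.

(** * Nonconstant functions and the algebra of composition *)

Definition nonconst (K : fieldType) (f : ratfun K) : bool :=
  (1 < maxn (size (rf_num f)) (size (rf_den f)))%N.

(** Coprimality forces the factor relating [n] and [d] to the reduced pair to be a nonzero constant,
    which leaves sizes unchanged. *)
Lemma nonconst_fracE (K : fieldType) (f : ratfun K) (n d : {poly K}) :
  coprimep n d -> d != 0 -> f = n%:F / d%:F ->
  nonconst f = (1 < maxn (size n) (size d))%N.
Proof.
move=> cop d0 fE; have [c c0 [nE dE]] := ratfun_ratioE d0 fE.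
move: cop; rewrite nE dE coprimepMl => /andP[].
rewrite coprimepMr => /andP[]; rewrite coprimepp => /size_poly1P[a a0 ->] _ _.
by rewrite !mul_polyC !size_scale.
Qed.

Lemma nonconst_const (K : fieldType) (c : K) : nonconst (rf_const K c) = false.
Proof.
rewrite (@nonconst_fracE _ _ c%:P 1) ?coprimep1 ?oner_neq0 //; last first.
  by rewrite rmorph1 divr1.
rewrite size_poly1; apply/negbTE; rewrite -leqNgt geq_max andbT.
exact: size_polyC_leq1.
Qed.

Lemma nonconstPn (K : fieldType) (f : ratfun K) :
  ~~ nonconst f -> exists c, f = rf_const K c.
Proof.
rewrite -leqNgt geq_max => /andP[/size1_polyC nE /size1_polyC dE].
exists ((rf_num f)`_0 / (rf_den f)`_0).
by rewrite fmorph_div /= -nE -dE; exact: ratfunE.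
Qed.

(** A nonconstant $h = A/B$ is transcendental over [K]. If $n(h) = 0$, the homogenization of [n] is
    0; being coprime to [B], it makes [B] constant. Then [A] has the larger degree, and the
    homogenization has the size of a power of [A], so it is not 0. *)
Lemma rf_eval_neq0 (K : fieldType) (h : ratfun K) (n : {poly K}) :
  nonconst h -> n != 0 -> eval_morph h n != 0.
Proof.
rewrite eval_morphE => hh n0; have := rf_coprime h; have := rf_den_neq0 h; move: hh.
rewrite /nonconst [X in rf_eval _ X]ratfunE.
move: (rf_num h) (rf_den h) => A B AB B0 cop.
have sn : size n = (size n).-1.+1 by rewrite prednK // size_poly_gt0.
have BF : B%:F != 0 :> ratfun K by rewrite tofrac_eq0.
apply/eqP => e0; have := @rf_eval_homog _ (size n).-1 n A B B0.
rewrite -sn leqnn e0 mul0r => /(_ isT)/esym/eqP.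
rewrite tofrac_eq0; apply/negP.
have lc0 : n`_(size n).-1 != 0 by rewrite -/(lead_coef n) lead_coef_eq0.
have := homog_coprime_den cop lc0.
have [h0 | //] := eqVneq (homog _ _ _ _) 0; rewrite h0 coprimep0.
rewrite -size_poly_eq1 => /eqP sB.
have {}AB : (size B < size A)%N by move: AB; rewrite leq_max sB ltnn orbF.
have A0 : A != 0 by rewrite -size_poly_gt0 (leq_trans _ AB).
have := size_homog AB lc0; rewrite h0 size_poly0 => /esym/eqP.
by rewrite size_poly_eq0 expf_eq0 (negPf A0) andbF.
Qed.

Lemma rf_comp_morphism (K : fieldType) (h : ratfun K) : nonconst h ->
  exists phi : {rmorphism ratfun K -> ratfun K}, forall p, phi p = rf_comp p h.
Proof.
move=> hh; have einj n : n != 0 -> eval_morph h n != 0 by exact: rf_eval_neq0.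
by have [phi phiE] := frac_lift_rmorphism einj; exists phi.
Qed.

Lemma rf_comp_poly (K : fieldType) (n : {poly K}) (h : ratfun K) :
  rf_comp n%:F h = rf_eval n h.
Proof.
have e1 : rf_eval 1 h = 1 by rewrite -eval_morphE rmorph1.
by rewrite -[n%:F]divr1 -(rmorph1 (@FracField.tofrac _)) rf_comp_fracE e1
           ?oner_neq0 ?divr1.
Qed.

Lemma rf_comp_const (K : fieldType) (c : K) (h : ratfun K) :
  rf_comp (rf_const K c) h = rf_const K c.
Proof. by rewrite rf_comp_poly rf_evalE map_polyC hornerC. Qed.

Lemma rf_compX (K : fieldType) (h : ratfun K) : rf_comp (rf_X K) h = h.
Proof. by rewrite rf_comp_poly rf_evalE map_polyX hornerX. Qed.

Lemma rf_eval_const (K : fieldType) (n : {poly K}) (c : K) :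
  rf_eval n (rf_const K c) = rf_const K n.[c].
Proof.
by rewrite rf_evalE horner_map.
Qed.

Lemma rf_evalX (K : fieldType) (n : {poly K}) : rf_eval n (rf_X K) = n%:F.
Proof.
rewrite /rf_eval (map_poly_comp (@FracField.tofrac {poly K}) (@polyC K)).
by rewrite horner_map /= -/(comp_poly 'X n) comp_polyXr.
Qed.

Lemma rf_comp_X (K : fieldType) (p : ratfun K) : rf_comp p (rf_X K) = p.
Proof. by rewrite /rf_comp !rf_evalX -ratfunE. Qed.

Lemma nonconst_compl (K : fieldType) (p h : ratfun K) :
  nonconst (rf_comp p h) -> nonconst p.
Proof.
apply: contraTT => /nonconstPn[c ->].
by rewrite rf_comp_const nonconst_const.
Qed.

Lemma nonconst_compr (K : fieldType) (p h : ratfun K) :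
  nonconst (rf_comp p h) -> nonconst h.
Proof.
apply: contraTT => /nonconstPn[c ->].
by rewrite /rf_comp !rf_eval_const -fmorph_div nonconst_const.
Qed.

(** Composition with [h] on the right is a field morphism fixing constants, so it carries evaluation
    at [q] to evaluation at $q \circ h$. A constant [q] at a pole of [p] is covered too, since field
    morphisms preserve the convention that 0 has inverse 0. *)
Lemma rf_compA (K : fieldType) (p q h : ratfun K) : nonconst h ->
  rf_comp (rf_comp p q) h = rf_comp p (rf_comp q h).
Proof.
move=> hh; have [phi phiE] := rf_comp_morphism hh.
have phi_eval n : phi (rf_eval n q) = rf_eval n (phi q).
  rewrite !rf_evalE -horner_map -map_poly_comp; congr (_.[_]).
  by apply: eq_map_poly => c; rewrite /= phiE; exact: rf_comp_const.
by rewrite -!phiE [rf_comp p q]/rf_comp rmorphM fmorphV /= !phi_eval.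
Qed.

Lemma rf_comp_inj (K : fieldType) (p q h : ratfun K) : nonconst h ->
  rf_comp p h = rf_comp q h -> p = q.
Proof.
move=> hh; have [phi phiE] := rf_comp_morphism hh.
by rewrite -!phiE; exact: fmorph_inj.
Qed.

(** * Extension of the base field *)

Lemma rf_map_polyE (K L : fieldType) (i : {rmorphism K -> L}) (n : {poly K}) :
  rf_map i n%:F = (map_poly i n)%:F.
Proof.
rewrite -[n%:F]divr1 -(rmorph1 (@FracField.tofrac _)) rf_map_fracE ?oner_neq0 //.
by rewrite !rmorph1 divr1.
Qed.

Lemma nonconst_map (K L : fieldType) (i : {rmorphism K -> L}) (f : ratfun K) :
  nonconst (rf_map i f) = nonconst f.
Proof.
rewrite (@nonconst_fracE _ _ (map_poly i (rf_num f)) (map_poly i (rf_den f))) //.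
- by rewrite !size_map_poly.
- by rewrite coprimep_map rf_coprime.
- by rewrite map_poly_eq0 rf_den_neq0.
Qed.

Lemma rf_map_comp (K L : fieldType) (i : {rmorphism K -> L}) (p h : ratfun K) :
  nonconst h -> rf_map i (rf_comp p h) = rf_comp (rf_map i p) (rf_map i h).
Proof.
move=> hh; have [phi phiE] := rf_map_morphism i.
have phi_eval n : phi (rf_eval n h) = rf_eval (map_poly i n) (phi h).
  rewrite !rf_evalE -horner_map -!map_poly_comp; congr (_.[_]).
  by apply: eq_map_poly => c; rewrite /= phiE rf_map_polyE map_polyC.
rewrite -!phiE [rf_comp p h]/rf_comp rmorphM fmorphV /= !phi_eval (phiE p).
(* The mapped numerator and denominator of [p] need not be the chosen reduced pair of [rf_map i p],
   so composing through them requires the denominator not to vanish at the image of [h]. *)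
rewrite rf_comp_fracE // -eval_morphE.
apply: rf_eval_neq0; first by rewrite phiE nonconst_map.
by rewrite map_poly_eq0 rf_den_neq0.
Qed.

Lemma rf_map_map (K L M : fieldType) (i : {rmorphism K -> L})
    (j : {rmorphism L -> M}) (f : ratfun K) :
  rf_map j (rf_map i f) = rf_map (j \o i) f.
Proof.
by rewrite rf_map_fracE ?map_poly_eq0 ?rf_den_neq0 // -!map_poly_comp.
Qed.

Lemma eq_rf_map (K L : fieldType) (i j : {rmorphism K -> L}) (f : ratfun K) :
  i =1 j -> rf_map i f = rf_map j f.
Proof. by move=> eq_ij; rewrite /rf_map !(eq_map_poly eq_ij). Qed.

(** * Units as Möbius transformations *)

Definition mobius (K : fieldType) (a b c d : K) : ratfun K :=
  (a *: 'X + b%:P)%:F / (c *: 'X + d%:P)%:F.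

Lemma linear_poly_neq0 (K : fieldType) (a b c d : K) :
  a * d - b * c != 0 -> c *: 'X + d%:P != 0 :> {poly K}.
Proof.
apply: contraNneq => /polyP e.
have := e 0; have := e 1; rewrite !coefE /= mulr1 mulr0 addr0 add0r => -> ->.
by rewrite !mulr0 subr0.
Qed.

Lemma rf_eval_linear (K : fieldType) (a b : K) (h : ratfun K) :
  rf_eval (a *: 'X + b%:P) h = rf_const K a * h + rf_const K b.
Proof.
by rewrite rf_evalE rmorphD /= map_polyZ map_polyX map_polyC !hornerE.
Qed.

Lemma rf_comp_mobius (K : fieldType) (a b c d : K) (h : ratfun K) :
  a * d - b * c != 0 -> nonconst h ->
  rf_comp (mobius a b c d) h =
    (rf_const K a * h + rf_const K b) / (rf_const K c * h + rf_const K d).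
Proof.
move=> det hh; rewrite rf_comp_fracE ?rf_eval_linear //.
by rewrite -rf_eval_linear -eval_morphE rf_eval_neq0 ?(linear_poly_neq0 det).
Qed.

(** A constant value [e] would make the row [(a, b)] equal to [e] times [(c, d)], so the determinant
    would vanish. *)
Lemma nonconst_mobius (K : fieldType) (a b c d : K) :
  a * d - b * c != 0 -> nonconst (mobius a b c d).
Proof.
move=> det; apply/negPn/negP => /nonconstPn[e uE]; move/negP: (det); apply.
have D0 : (c *: 'X + d%:P)%:F != 0 :> ratfun K.
  by rewrite tofrac_eq0 (linear_poly_neq0 det).
have := canRL (divfK D0) uE => /eqP; rewrite /= -rmorphM /= tofrac_eq => /eqP/polyP E.
have := E 0; have := E 1; rewrite !coefE /= !mulr1 !mulr0 !addr0 !add0r => -> ->.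
by rewrite mulrAC subrr.
Qed.

Lemma homographic_comp (L : fieldType) (a b c d a' b' c' d' x : L) :
  c' * x + d' != 0 ->
  (a * ((a' * x + b') / (c' * x + d')) + b) /
    (c * ((a' * x + b') / (c' * x + d')) + d) =
  ((a * a' + b * c') * x + (a * b' + b * d')) /
    ((c * a' + d * c') * x + (c * b' + d * d')).
Proof.
move=> D0; rewrite -(div_scale _ (c * _ + d) D0); congr (_ / _).
  by field.
by field.
Qed.

Lemma comp_mobius (K : fieldType) (a b c d a' b' c' d' : K) :
  a * d - b * c != 0 -> a' * d' - b' * c' != 0 ->
  rf_comp (mobius a b c d) (mobius a' b' c' d') =
  mobius (a * a' + b * c') (a * b' + b * d')
         (c * a' + d * c') (c * b' + d * d').
Proof.
move=> det det'; rewrite rf_comp_mobius ?nonconst_mobius //.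
have linE (s t : K) :
    (s *: 'X + t%:P)%:F = rf_const K s * rf_X K + rf_const K t.
  by rewrite -rf_evalX rf_eval_linear.
rewrite /mobius !linE !rmorphD !rmorphM.
by rewrite homographic_comp // -linE tofrac_eq0 (linear_poly_neq0 det').
Qed.

Lemma mobius_scalar (K : fieldType) (e : K) : e != 0 -> mobius e 0 0 e = rf_X K.
Proof.
move=> e0; rewrite /mobius addr0 scale0r add0r.
rewrite -mul_polyC rmorphM /= mulrC mulKf //.
by rewrite tofrac_eq0 polyC_eq0.
Qed.

Lemma mobius_inverse (K : fieldType) (a b c d : K) : a * d - b * c != 0 ->
  comp_inverse (mobius a b c d) (mobius d (- b) (- c) a).
Proof.
move=> det; have det' : d * a - (- b) * (- c) != 0 by rewrite mulrNN mulrC.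
(* A matrix times its adjugate is the determinant times the identity, and scalar matrices act as
   [rf_X]. *)
split; rewrite comp_mobius // -[RHS](mobius_scalar det); congr mobius; ring.
Qed.

Lemma unit_inverse (K : fieldType) (u : ratfun K) : is_unit u ->
  exists2 v, is_unit v & comp_inverse u v.
Proof.
move=> [a [b [c [d [det ->]]]]]; exists (mobius d (- b) (- c) a).
  by exists d, (- b), (- c), a; rewrite mulrNN [d * a]mulrC.
exact: mobius_inverse.
Qed.

Lemma unit_nonconst (K : fieldType) (u : ratfun K) : is_unit u -> nonconst u.
Proof. by move=> [a [b [c [d [det ->]]]]]; exact: nonconst_mobius. Qed.

Lemma unit_comp (K : fieldType) (u v : ratfun K) :
  is_unit u -> is_unit v -> is_unit (rf_comp u v).
Proof.
move=> [a [b [c [d [det ->]]]]] [a' [b' [c' [d' [det' ->]]]]].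
exists (a * a' + b * c'), (a * b' + b * d'), (c * a' + d * c'), (c * b' + d * d').
split; last exact: comp_mobius.
have -> : (a * a' + b * c') * (c * b' + d * d')
          - (a * b' + b * d') * (c * a' + d * c')
          = (a * d - b * c) * (a' * d' - b' * c') by ring.
exact: mulf_neq0.
Qed.

Lemma unit_map (K L : fieldType) (i : {rmorphism K -> L}) (u : ratfun K) :
  is_unit u -> is_unit (rf_map i u).
Proof.
move=> [a [b [c [d [det ->]]]]]; exists (i a), (i b), (i c), (i d); split.
  by rewrite -!rmorphM -rmorphB fmorph_eq0.
rewrite rf_map_fracE ?(linear_poly_neq0 det) //.
by rewrite !rmorphD /= !map_polyZ !map_polyX !map_polyC.
Qed.

(** * Composition equations cleared of denominators *)

Lemma cross_eq_div (L : fieldType) (a b c d : L) :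
  b != 0 -> d != 0 -> a * d = c * b -> a / b = c / d.
Proof. by move=> b0 d0 E; apply/eqP; rewrite eqr_div // E. Qed.

Lemma homog_neq0 (K : fieldType) (k : nat) (n A B : {poly K}) :
  B != 0 -> nonconst (A%:F / B%:F) -> (size n <= k.+1)%N -> n != 0 ->
  homog k n A B != 0.
Proof.
move=> B0 hh sn n0; apply/eqP => h0.
have := rf_eval_homog A B0 sn; rewrite h0 rmorph0 => /eqP.
rewrite mulf_eq0 => /orP[/eqP e|].
  by have := rf_eval_neq0 hh n0; rewrite eval_morphE e eqxx.
by rewrite expf_eq0 tofrac_eq0 (negPf B0) andbF.
Qed.

(** Homogenizing [Q] and [R] in the same degree multiplies the numerator and denominator of the
    composite by the same power of [B], which cancels. *)
Lemma comp_frac_eqP (K : fieldType) (k : nat) (n d Q R A B : {poly K}) :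
  d != 0 -> R != 0 -> B != 0 -> nonconst (A%:F / B%:F) ->
  (size Q <= k.+1)%N -> (size R <= k.+1)%N ->
  n%:F / d%:F = rf_comp (Q%:F / R%:F) (A%:F / B%:F) <->
  n * homog k R A B = d * homog k Q A B.
Proof.
move=> d0 R0 B0 hh sQ sR.
have eR0 : rf_eval R (A%:F / B%:F) != 0.
  by rewrite -eval_morphE rf_eval_neq0.
have Bk0 : B%:F ^+ k != 0 :> ratfun K by rewrite expf_neq0 ?tofrac_eq0.
have dF0 : d%:F != 0 :> ratfun K by rewrite tofrac_eq0.
rewrite rf_comp_fracE // -(div_scale _ (rf_eval R _) Bk0).
rewrite ![B%:F ^+ k * _]mulrC !rf_eval_homog //.
have hR0 : (homog k R A B)%:F != 0 :> ratfun K.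
  by rewrite tofrac_eq0 homog_neq0.
split=> [/(eq_div_cross dF0 hR0 erefl)/eqP | E].
  by rewrite -(tofracM n) -(tofracM _ d) tofrac_eq [_ * d]mulrC => /eqP.
apply: (cross_eq_div dF0 hR0).
by rewrite -(tofracM n) -(tofracM _ d) E mulrC.
Qed.

(** * Normal forms of explicit fractions, and the divisibility they force *)

Definition normal_frac (K : fieldType) (n d : {poly K}) : Prop :=
  [/\ coprimep n d, (size d < size n)%N & n`_0 = 0].

Lemma invr_div_subr (L : fieldType) (a b c : L) :
  b != 0 -> (a / b - c)^-1 = b / (a - c * b).
Proof. by move=> b0; rewrite -{1}[c](mulfK b0) -mulrBl invf_div. Qed.

Lemma tofracZ (K : fieldType) (c : K) (B : {poly K}) :
  (c *: B)%:F = rf_const K c * B%:F.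
Proof. by rewrite -mul_polyC rmorphM. Qed.

Lemma normal_frac_den0 (K : fieldType) (n d : {poly K}) :
  normal_frac n d -> d`_0 != 0.
Proof.
move=> [cop _ n0]; rewrite -horner_coef0; apply: (coprimep_root cop).
by rewrite rootE horner_coef0 n0.
Qed.

Lemma normal_frac_den_neq0 (K : fieldType) (n d : {poly K}) :
  normal_frac n d -> d != 0.
Proof. by move/normal_frac_den0; apply: contraNneq => ->; rewrite coef0. Qed.

Lemma nonconst_size (K : fieldType) (A B : {poly K}) :
  coprimep A B -> B != 0 -> (size B < size A)%N -> nonconst (A%:F / B%:F).
Proof.
move=> cop B0 sAB; rewrite (nonconst_fracE cop) // leq_max.
by rewrite (leq_ltn_trans _ sAB) // size_poly_gt0.
Qed.

Lemma nonconst_normal_frac (K : fieldType) (n d : {poly K}) :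
  normal_frac n d -> nonconst (n%:F / d%:F).
Proof.
move=> nf; have d0 := normal_frac_den_neq0 nf.
by case: nf => cop sdn _; apply: nonconst_size.
Qed.

Lemma normal_frac_map (K L : fieldType) (i : {rmorphism K -> L})
    (n d : {poly K}) :
  normal_frac n d -> normal_frac (map_poly i n) (map_poly i d).
Proof.
move=> [cop s n0].
split; rewrite ?coprimep_map ?size_map_poly //.
by rewrite coef_map /= n0 rmorph0.
Qed.

(* [Q / R] has a pole at infinity, since [n / d] does and [A / B] fixes
   infinity. *)
Lemma size_outer_gt (K : fieldType) (n d Q R A B : {poly K}) :
  normal_frac n d -> R != 0 -> B != 0 ->
  coprimep A B -> (size B < size A)%N ->
  n%:F / d%:F = rf_comp (Q%:F / R%:F) (A%:F / B%:F) -> (size R < size Q)%N.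
Proof.
move=> nf R0 B0 cop sAB E; have hh := nonconst_size cop B0 sAB.
have d0 := normal_frac_den_neq0 nf; case: nf => _ sdn _.
rewrite ltnNge; apply/negP => sQR.
have sR : size R = (size R).-1.+1 by rewrite prednK // size_poly_gt0.
have := sQR; rewrite {1}sR => sQ.
have [key _] := comp_frac_eqP n d0 R0 B0 hh sQ (eq_leq sR).
have {key} := congr1 (size : {poly K} -> nat) (key E).
have lR0 : R`_(size R).-1 != 0 by rewrite -/(lead_coef R) lead_coef_eq0.
have n0 : n != 0 by rewrite -size_poly_gt0 (leq_trans _ sdn).
(* In degree $k = \deg R$ the homogenization of [R] has exactly the degree of $A^k$ and that of [Q]
   at most this degree. As $\deg d < \deg n$, the two sides of [key] differ in degree. *)
have hR := size_homog sAB lR0; have hQ := size_homog_leq (size R).-1 Q sAB.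
have A0 : A != 0 by rewrite -size_poly_gt0 (leq_trans _ sAB).
have sA0 : (0 < size (A ^+ (size R).-1)) %N by rewrite size_poly_gt0 expf_neq0.
have hR0 : homog (size R).-1 R A B != 0 by rewrite -size_poly_gt0 hR.
rewrite size_mul // hR; apply/eqP; rewrite eq_sym ltn_eqF //.
apply: (leq_ltn_trans (size_polyMleq _ _)).
rewrite ltn_predRL prednK ?addn_gt0 ?size_poly_gt0 ?d0 //.
by rewrite -addSn leq_add.
Qed.

(* [Q / R] has a pole at infinity, so a pole of [A / B] at 0 would be a pole of
   [n / d]. *)
Lemma inner_den0 (K : fieldType) (n d Q R A B : {poly K}) :
  normal_frac n d -> R != 0 -> B != 0 ->
  coprimep A B -> (size B < size A)%N ->
  n%:F / d%:F = rf_comp (Q%:F / R%:F) (A%:F / B%:F) -> B.[0] != 0.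
Proof.
move=> nf R0 B0 cop sAB E; have hh := nonconst_size cop B0 sAB.
have sRQ := size_outer_gt nf R0 B0 cop sAB E.
have d0 := normal_frac_den_neq0 nf; have dv0 := normal_frac_den0 nf.
case: nf => _ sdn nv0.
have Q0 : Q != 0 by rewrite -size_poly_gt0 (leq_trans _ sRQ).
have sQ : size Q = (size Q).-1.+1 by rewrite prednK // size_poly_gt0.
have sR : (size R <= (size Q).-1.+1)%N by rewrite -sQ ltnW.
have lQ0 : Q`_(size Q).-1 != 0 by rewrite -/(lead_coef Q) lead_coef_eq0.
have [key _] := comp_frac_eqP n d0 R0 B0 hh (eq_leq sQ) sR.
(* At 0, $n(0) = 0$ and $d(0) \neq 0$ force the homogenization of [Q] to vanish; [B] is coprime to
   it, so [B] does not vanish there. *)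
have {key} := key E => /(congr1 (fun p => p.[0])).
rewrite !hornerM !horner_coef0 nv0 mul0r => /esym/eqP.
rewrite mulf_eq0 (negPf dv0) -!horner_coef0 /= => hQ0.
have cQ := homog_coprime_den cop lQ0; rewrite coprimep_sym in cQ.
exact: (coprimep_root cQ).
Qed.

(* With [P = Q / R], clearing denominators gives [n * R^ = d * Q^] for the
   homogenizations at [(A, B)]; [A] divides [Q^] and is coprime to [R^], [B]
   divides [R^] and is coprime to [Q^]. *)
Lemma normal_comp_dvd (K : fieldType) (n d A B : {poly K}) (P : ratfun K) :
  normal_frac n d -> normal_frac A B ->
  n%:F / d%:F = rf_comp P (A%:F / B%:F) -> A %| n /\ B %| d.
Proof.
rewrite [X in rf_comp X]ratfunE; move: (rf_coprime P) (rf_den_neq0 P).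
move: (rf_num P) (rf_den P) => Q R copQR R0 nf nfH E.
have B0 := normal_frac_den_neq0 nfH; have Bv0 := normal_frac_den0 nfH.
case: nfH => cop sAB Av0; have hh := nonconst_size cop B0 sAB.
have sRQ := size_outer_gt nf R0 B0 cop sAB E.
have d0 := normal_frac_den_neq0 nf; have dv0 := normal_frac_den0 nf.
case: nf => _ sdn nv0.
have Q0 : Q != 0 by rewrite -size_poly_gt0 (leq_trans _ sRQ).
have sQ : size Q = (size Q).-1.+1 by rewrite prednK // size_poly_gt0.
have sR : (size R <= (size Q).-1.+1)%N by rewrite -sQ ltnW.
have lQ0 : Q`_(size Q).-1 != 0 by rewrite -/(lead_coef Q) lead_coef_eq0.
have [key _] := comp_frac_eqP n d0 R0 B0 hh (eq_leq sQ) sR.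
have {}key := key E.
(* Evaluating [key] at 0, where [n] and [A] vanish, leaves $d(0) Q(0) B(0)^k = 0$. *)
have Qv0 : Q`_0 = 0.
  have := congr1 (fun p => p.[0]) key.
  rewrite !hornerM !horner_coef0 nv0 mul0r => /esym/eqP.
  rewrite mulf_eq0 (negPf dv0) -horner_coef0 /=.
  have [q ->] := homog_lowE (size Q).-1 Q A B.
  rewrite !hornerE !horner_coef0 Av0 mulr0 add0r mulf_eq0.
  by rewrite expf_eq0 (negPf Bv0) andbF orbF => /eqP.
have Rv0 : R`_0 != 0.
  by rewrite -horner_coef0 (coprimep_root copQR) // rootE horner_coef0 Qv0.
(* Homogenized in degree $\deg Q > \deg R$, [R] acquires a spare factor [B]. *)
have lR0 : R`_(size Q).-1 = 0 by rewrite nth_default // -ltnS -sQ.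
split.
  rewrite -(Gauss_dvdpl _ (homog_coprime_num (size Q).-1 cop Rv0)) key.
  exact/dvdp_mull/homog_dvd_num.
rewrite -(Gauss_dvdpl _ (homog_coprime_den cop lQ0)) -key.
exact/dvdp_mull/homog_dvd_den.
Qed.

(** * Units bringing the inner function to normal form *)

Lemma unit_at_infinity (K : fieldType) (h : ratfun K) : nonconst h ->
  exists2 w, is_unit w & exists A B,
    [/\ rf_comp w h = A%:F / B%:F, coprimep A B, B != 0 & (size B < size A)%N].
Proof.
move=> hh; have := rf_coprime h; have := rf_den_neq0 h.
have := ratfunE h; have := hh; rewrite /nonconst.
move: (rf_num h) (rf_den h) => A B sAB hE B0 cop.
have [lt_BA | le_AB] := ltnP (size B) (size A).
  exists (rf_X K); last by exists A, B; rewrite rf_compX.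
  exists 1, 0, 0, 1; rewrite mulr1 mulr0 subr0 oner_neq0; split=> //.
  by rewrite -(mobius_scalar (oner_neq0 K)).
(* [c] is the finite value of $A/B$ at infinity, 0 when $\deg A < \deg B$; the unit $1/(x - c)$
   sends it to infinity. *)
pose c := A`_(size B).-1 / lead_coef B.
have det : 0 * (- c) - 1 * 1 != 0 by rewrite mul0r add0r mulr1 oppr_eq0 oner_neq0.
exists (mobius 0 1 1 (- c)); first by exists 0, 1, 1, (- c).
have sB : (1 < size B)%N by move: sAB; rewrite (maxn_idPr le_AB).
have cop' : coprimep B (A - c *: B).
  by rewrite addrC -mul_polyC -mulNr coprimep_addl_mul coprimep_sym.
have A'0 : A - c *: B != 0.
  apply: contraTneq cop' => ->; rewrite coprimep0 -size_poly_eq1.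
  by rewrite neq_ltn sB orbT.
exists B, (A - c *: B); split=> //.
  have BF0 : B%:F != 0 :> ratfun K by rewrite tofrac_eq0.
  rewrite rf_comp_mobius // hE rmorph0 rmorph1 mul0r add0r !mul1r rmorphN.
  by rewrite invr_div_subr // rmorphB /= tofracZ.
have le : (size (A - c *: B)%R <= size B)%N.
  by rewrite (leq_trans (size_polyD _ _)) // geq_max le_AB size_polyN size_scale_leq.
(* The choice of [c] cancels the coefficient in degree $\deg B$, so equal sizes would give a zero
   leading coefficient. *)
rewrite ltn_neqAle le andbT; apply: contraNneq A'0 => sE.
rewrite -lead_coef_eq0 /lead_coef sE coefB coefZ -/(lead_coef B) divfK ?subrr //.
by rewrite lead_coef_eq0.
Qed.

Lemma unit_normalizing (K : fieldType) (n d : {poly K}) (P H : ratfun K) :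
  normal_frac n d -> n%:F / d%:F = rf_comp P H ->
  exists2 w, is_unit w & exists2 AB, normal_frac AB.1 AB.2 &
    rf_comp w H = AB.1%:F / AB.2%:F.
Proof.
move=> nf E; have ng := nonconst_normal_frac nf.
have hH : nonconst H by move: ng; rewrite E => /nonconst_compr.
have [w wU [A [B [wE cop B0 sAB]]]] := unit_at_infinity hH.
have [v vU [wv vw]] := unit_inverse wU.
have nwH : nonconst (rf_comp w H) by rewrite wE nonconst_size.
(* Moving [w] to the outer function as [v] keeps the composite, so [inner_den0] applies to $A/B$. *)
have B00 : B.[0] != 0.
  have E' : n%:F / d%:F = rf_comp (rf_comp P v) (A%:F / B%:F).
    by rewrite -wE rf_compA // -[rf_comp v _]rf_compA // vw rf_compX.
  move: E'; rewrite [rf_comp P v]ratfunE; apply: inner_den0 => //.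
  exact: rf_den_neq0.
(* Subtracting the value at 0 makes the numerator vanish there and keeps the pole at infinity. *)
pose c := A.[0] / B.[0].
have det : 1 * 1 - (- c) * 0 != 0 by rewrite mulr0 subr0 mulr1 oner_neq0.
have tU : is_unit (mobius 1 (- c) 0 1) by exists 1, (- c), 0, 1.
exists (rf_comp (mobius 1 (- c) 0 1) w); first exact: unit_comp.
exists (A - c *: B, B) => /=.
  split; last by rewrite -horner_coef0 !hornerE divfK ?subrr.
    rewrite coprimep_sym addrC -mul_polyC -mulNr coprimep_addl_mul.
    by rewrite coprimep_sym.
  rewrite size_polyDl // size_polyN.
  exact: leq_ltn_trans (size_scale_leq _ _) sAB.
rewrite rf_compA // wE rf_comp_mobius ?nonconst_size //.
have BF0 : B%:F != 0 :> ratfun K by rewrite tofrac_eq0.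
rewrite rmorph0 rmorph1 mul0r add0r mul1r divr1.
by rewrite rmorphB rmorphN /= tofracZ mulrBl mulfK.
Qed.

(** * Descent from [Omega] to [F] *)

Lemma linear_relation_descent (F L : fieldType) (j : {rmorphism F -> L})
    (m : nat) (q : 'I_m -> {poly F}) (c : 'rV[L]_m) :
  c != 0 -> \sum_i c 0 i *: map_poly j (q i) = 0 ->
  exists2 e : 'rV[F]_m, e != 0 & \sum_i e 0 i *: q i = 0.
Proof.
move=> c0 crel; pose s := \max_i size (q i).
have sq i : (size (q i) <= s)%N by exact: (leq_bigmax i).
pose M : 'M[F]_(m, s) := \matrix_i poly_rV (q i).
(* Stated for any morphism out of [F]: [j] turns the given relation into one on the rows of [M], and
   [idfun] turns a row relation back into polynomials. *)
have rowsum (E : fieldType) (e : 'rV[E]_m) (f : {rmorphism F -> E}) :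
    e *m map_mx f M = poly_rV (\sum_i e 0 i *: map_poly f (q i)).
  rewrite mulmx_sum_row linear_sum; apply: eq_bigr => i _.
  by rewrite linearZ /= -map_row rowK map_poly_rV.
(* Row freeness is unchanged by field extension, so dependence over [L] gives dependence over
   [F]. *)
have freeN : ~~ row_free M.
  rewrite -(row_free_map j); apply: contra c0 => /row_freeP[N MN].
  by rewrite -[c]mulmx1 -MN mulmxA rowsum crel linear0 mul0mx.
have [e eM e0] : exists2 e : 'rV[F]_m, e *m M = 0 & e != 0.
  move: freeN; rewrite -kermx_eq0 => /rowV0Pn[e /sub_kermxP eM e0].
  by exists e.
exists e => //; have := rowsum _ e idfun.
rewrite map_mx_id // eM => /esym e0M.
have -> : \sum_i e 0 i *: q i = \sum_i e 0 i *: map_poly idfun (q i).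
  by apply: eq_bigr => i _; rewrite map_poly_id.
rewrite -[LHS](@poly_rV_K _ s) ?e0M ?linear0 //.
apply: (leq_trans (size_sum _ _ _)); apply/bigmax_leqP => i _.
by rewrite map_poly_id // (leq_trans (size_scale_leq _ _)).
Qed.

(* The coefficients of an outer function solve a homogeneous linear system with
   coefficients in [F]. *)
Lemma outer_descent (F L : fieldType) (j : {rmorphism F -> L})
    (g h : ratfun F) (P : ratfun L) :
  nonconst h -> rf_map j g = rf_comp P (rf_map j h) ->
  exists p, g = rf_comp p h.
Proof.
move=> hh; rewrite [P]ratfunE; move: (rf_den_neq0 P).
move: (rf_num P) (rf_den P) => Q R R0.
rewrite [g]ratfunE [h]ratfunE; have := rf_den_neq0 g; have := rf_den_neq0 h.
have := hh; rewrite {1}[h]ratfunE.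
move: (rf_num g) (rf_den g) (rf_num h) (rf_den h) => n d A B {}hh B0 d0.
rewrite !rf_map_fracE // => E.
have hhj : nonconst ((map_poly j A)%:F / (map_poly j B)%:F).
  by rewrite -rf_map_fracE // nonconst_map.
pose k := maxn (size Q) (size R).
have sQ : (size Q <= k.+1)%N by rewrite leqW // leq_maxl.
have sR : (size R <= k.+1)%N by rewrite leqW // leq_maxr.
have dj0 : map_poly j d != 0 by rewrite map_poly_eq0.
have Bj0 : map_poly j B != 0 by rewrite map_poly_eq0.
have [key _] := comp_frac_eqP (map_poly j n) dj0 R0 Bj0 hhj sQ sR.
have {key} := key E.
pose t (i : 'I_k.+1) := A ^+ i * B ^+ (k - i).
(* The first [k.+1] unknowns are the coefficients of the outer denominator, the others those of the
   numerator. A relation among the [q i] is then exactly the cleared composition equation. *)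
pose q (i : 'I_(k.+1 + k.+1)) :=
  match split i with inl i => n * t i | inr i => - (d * t i) end.
have ql i : q (lshift _ i) = n * t i by rewrite /q (unsplitK (inl _ _)).
have qr i : q (rshift _ i) = - (d * t i) by rewrite /q (unsplitK (inr _ _)).
move=> key; pose c : 'rV[L]_(k.+1 + k.+1) :=
  row_mx (\row_i R`_i) (\row_i Q`_i).
have crel : \sum_i c 0 i *: map_poly j (q i) = 0.
  rewrite big_split_ord /=.
  have -> : \sum_(i < k.+1) c 0 (lshift k.+1 i) *: map_poly j (q (lshift k.+1 i))
      = map_poly j n * homog k R (map_poly j A) (map_poly j B).
    rewrite mulr_sumr; apply: eq_bigr => i _.
    by rewrite row_mxEl mxE ql !rmorphM !rmorphXn scalerAr.
  have -> : \sum_(i < k.+1) c 0 (rshift k.+1 i) *: map_poly j (q (rshift k.+1 i))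
      = - (map_poly j d * homog k Q (map_poly j A) (map_poly j B)).
    rewrite mulr_sumr -sumrN; apply: eq_bigr => i _.
    by rewrite row_mxEr mxE qr rmorphN !rmorphM !rmorphXn scalerN scalerAr.
  by rewrite key subrr.
have c0 : c != 0.
  apply: contraNneq R0 => cE; apply/eqP/polyP => i; rewrite coef0.
  have [lt_ik | le_ki] := ltnP i k.+1; last first.
    by rewrite nth_default // (leq_trans sR).
  have := congr1 (fun M : 'rV[L]_(k.+1 + k.+1) => M 0 (lshift _ (Ordinal lt_ik))) cE.
  by rewrite row_mxEl !mxE.
have [e e0 erel] := linear_relation_descent c0 crel.
pose r := \poly_(i < k.+1) e 0 (lshift k.+1 (inord i)).
pose p := \poly_(i < k.+1) e 0 (rshift k.+1 (inord i)).
have homr : n * homog k r A B = d * homog k p A B.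
  apply/eqP; rewrite -subr_eq0 -erel big_split_ord /=; apply/eqP.
  rewrite !mulr_sumr -sumrN; congr (_ + _); apply: eq_bigr => i _.
    by rewrite ql coef_poly ltn_ord inord_val -scalerAr.
  by rewrite qr coef_poly ltn_ord inord_val scalerN -scalerAr.
(* If [r] were 0, the homogenization of [p] would be 0 as [d] is not; then [p] and the whole
   solution [e] would be 0. *)
have r0 : r != 0.
  apply: contraNneq e0 => rE.
  have pE : p = 0.
    apply/eqP; apply: contraTT isT => p0; move: homr; rewrite rE.
    rewrite [homog k 0 A B]big1 ?mulr0 => [/esym/eqP|i _]; last first.
      by rewrite coef0 scale0r.
    by rewrite mulf_eq0 (negPf d0) (negPf (homog_neq0 _ _ _ p0)) ?size_poly.
  apply/eqP/rowP => i; rewrite mxE -(splitK i); case: (split i) => l /=.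
    have := congr1 (fun f : {poly F} => f`_l) rE.
    by rewrite coef_poly ltn_ord inord_val coef0.
  have := congr1 (fun f : {poly F} => f`_l) pE.
  by rewrite coef_poly ltn_ord inord_val coef0.
exists (p%:F / r%:F).
by apply/(comp_frac_eqP n d0 r0 B0 hh (size_poly _ _) (size_poly _ _)).
Qed.

(** A divisor of a product of linear factors is, up to a constant, a subproduct, and its roots
    already lie in [F]. *)
Lemma split_divisor_descent (F L : fieldType) (j : {rmorphism F -> L})
    (p : {poly F}) (r : seq F) (q : {poly L}) :
  p %= \prod_(z <- r) ('X - z%:P) -> q %| map_poly j p ->
  exists s : {poly F}, q %= map_poly j s.
Proof.
move=> pE; have : map_poly j p %= \prod_(z <- r) ('X - (j z)%:P).
  rewrite -(eqp_map j) rmorph_prod /= in pE.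
  by under eq_bigr => z _ do rewrite -map_polyXsubC.
move/eqp_dvdr=> -> /dvdp_prod_XsubC[m qE].
exists (\prod_(z <- mask m r) ('X - z%:P)); apply: (eqp_trans qE).
rewrite rmorph_prod /=.
under [X in _ %= X]eq_bigr => z _ do rewrite map_polyXsubC.
exact: eqpxx.
Qed.

(** * Assembling the decomposition over [F] *)

Lemma comp_inverse_comp (K : fieldType) (u u' v v' : ratfun K) :
  is_unit u' -> is_unit u -> is_unit v -> is_unit v' ->
  comp_inverse u u' -> comp_inverse v v' ->
  comp_inverse (rf_comp u v) (rf_comp v' u').
Proof.
move=> u'U uU vU v'U [uu' u'u] [vv' v'v]; split.
  rewrite rf_compA ?unit_nonconst //; last exact: unit_comp.
  by rewrite -[rf_comp v _]rf_compA ?unit_nonconst // vv' rf_compX.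
rewrite rf_compA ?unit_nonconst //; last exact: unit_comp.
by rewrite -[rf_comp u' _]rf_compA ?unit_nonconst // u'u rf_compX.
Qed.

Lemma normal_formE (K : fieldType) (g : ratfun K) :
  normal_form g -> normal_frac (rf_num g) (rf_den g).
Proof. by case=> s n0; split; rewrite ?rf_coprime // -horner_coef0. Qed.

Theorem theorem10
  (K : fieldType) (f u1 u2 g : ratfun K)
  (hu1 : is_unit u1) (hu2 : is_unit u2)
  (hg : g = rf_comp u1 (rf_comp f u2))
  (hgn : normal_form g)
  (F : fieldExtType K)
  (hF : splitting_field2 F (rf_num g) (rf_den g))
  (K' : fieldType) (iK' : {rmorphism K -> K'})
  (Omega : fieldType)
  (jK' : {rmorphism K' -> Omega}) (jF : {rmorphism F -> Omega})
  (hj : forall a : K, jK' (iK' a) = jF (in_alg F a))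
  (p h : ratfun K')
  (hph : decomposition (rf_map iK' f) p h) :
  exists p2 h2 : ratfun F,
    decomposition (rf_map (in_alg F) f) p2 h2 /\
    equiv_decomp (rf_map jK' p) (rf_map jK' h) (rf_map jF p2) (rf_map jF h2).
Proof.
have nf := normal_formE hgn.
have ng : nonconst g by rewrite [g]ratfunE nonconst_normal_frac.
have nfu2 : nonconst (rf_comp f u2) by move: ng; rewrite hg => /nonconst_compr.
have nu2 := unit_nonconst hu2.
have nff : nonconst f := nonconst_compl nfu2.
have nh : nonconst h.
  by have := nff; rewrite -(nonconst_map iK') hph => /nonconst_compr.
pose iF : {rmorphism K -> F} := in_alg F; rewrite -/iF in hF hj *.
pose lift (x : ratfun K) := rf_map jF (rf_map iF x).
have lift_comp (x y : ratfun K) :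
    nonconst y -> lift (rf_comp x y) = rf_comp (lift x) (lift y).
  by move=> ny; rewrite /lift !rf_map_comp // nonconst_map.
have lift_unit x : is_unit x -> is_unit (lift x) by move=> xU; do 2!apply: unit_map.
(* The two embeddings of [K] into [Omega], through [F] and through [K'], agree by [hj]. *)
have lift_f : lift f = rf_comp (rf_map jK' p) (rf_map jK' h).
  rewrite -rf_map_comp // -hph /lift !rf_map_map; apply: eq_rf_map => a /=.
  exact/esym/hj.
have nhO : nonconst (rf_map jK' h) by rewrite nonconst_map.
have nu2O := unit_nonconst (lift_unit _ hu2).
have lift_g : lift g = rf_comp (rf_comp (lift u1) (rf_map jK' p))
                               (rf_comp (rf_map jK' h) (lift u2)).
  have nfu2O : nonconst (rf_comp (lift f) (lift u2)).
    by rewrite -lift_comp // !nonconst_map.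
  have E : rf_comp (lift f) (lift u2)
      = rf_comp (rf_map jK' p) (rf_comp (rf_map jK' h) (lift u2)).
    by rewrite lift_f rf_compA.
  rewrite rf_compA ?hg ?lift_comp // ?E //.
  by move: nfu2O; rewrite E => /nonconst_compr.
pose gn := map_poly iF (rf_num g); pose gd := map_poly iF (rf_den g).
have lift_gE : lift g = (map_poly jF gn)%:F / (map_poly jF gd)%:F.
  by rewrite /lift [rf_map iF g]/rf_map rf_map_fracE // map_poly_eq0 rf_den_neq0.
have nfO := normal_frac_map jF (normal_frac_map iF nf).
rewrite lift_gE in lift_g.
have [w wU [[A B] /= nfH wE]] := unit_normalizing nfO lift_g.
have [v vU [wv vw]] := unit_inverse wU.
have nAB := nonconst_normal_frac nfH; have nwH := nAB; rewrite -wE in nwH.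
have nH := nonconst_compr nwH.
have vAB : rf_comp v (A%:F / B%:F) = rf_comp (rf_map jK' h) (lift u2).
  by rewrite -wE -rf_compA // vw rf_compX.
(* The unit [v] passes to the outer function, leaving the normal $A/B$ as inner function of [g]. *)
rewrite -vAB -rf_compA // in lift_g.
have [dA dB] := normal_comp_dvd nfO nfH lift_g.
case: hF => rn [rd [gnE gdE _]].
have [a /eqpf_eq[ca ca0 AE]] := split_divisor_descent gnE dA.
have [b /eqpf_eq[cb cb0 BE]] := split_divisor_descent gdE dB.
have b0 : b != 0.
  apply: contraNneq (normal_frac_den_neq0 nfH) => bE.
  by rewrite BE bE map_poly0 scaler0.
(* [s] multiplies by [ca / cb], the constants by which [A] and [B] differ from the images of [a] and
   [b]. *)
pose H2 := a%:F / b%:F; pose s := mobius ca 0 0 cb.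
have det_s : ca * cb - 0 * 0 != 0 by rewrite mul0r subr0 mulf_neq0.
have sU : is_unit s by exists ca, 0, 0, cb.
have ABE : A%:F / B%:F = rf_comp s (rf_map jF H2).
  have bj0 : map_poly jF b != 0 by rewrite map_poly_eq0.
  have nH2O : nonconst ((map_poly jF a)%:F / (map_poly jF b)%:F).
    have cop : coprimep (map_poly jF a) (map_poly jF b).
      by case: nfH; rewrite AE BE coprimepZl // coprimepZr.
    case: nfH => _ sBA _; rewrite nonconst_size //.
    by move: sBA; rewrite AE BE !size_scale.
  rewrite rf_map_fracE // rf_comp_mobius // rmorph0 mul0r addr0 add0r.
  by rewrite AE BE !tofracZ -mulf_div mulrAC.
have nH2 : nonconst H2.
  by rewrite -(nonconst_map jF); move: nAB; rewrite ABE => /nonconst_compr.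
have [t tU [st ts]] := unit_inverse sU.
have [P2 P2E] : exists P2, rf_map iF g = rf_comp P2 H2.
  apply: (outer_descent nH2 (etrans (etrans lift_gE lift_g) _)).
  by rewrite ABE -rf_compA // nonconst_map.
have [v1 v1U [uv1 vu1]] := unit_inverse hu1.
have [v2 v2U [uv2 vu2]] := unit_inverse hu2.
have nv2 := unit_nonconst v2U; have nv2F : nonconst (rf_map iF v2).
  by rewrite nonconst_map.
have fE : f = rf_comp v1 (rf_comp g v2).
  rewrite hg rf_compA // [rf_comp (rf_comp f u2) v2]rf_compA // uv2 rf_comp_X.
  by rewrite -rf_compA // vu1 rf_compX.
have ngv2 : nonconst (rf_comp g v2) by move: nff; rewrite {1}fE => /nonconst_compr.
(* From $f = v_1 \circ g \circ v_2$ and $g = P_2 \circ H_2$, the units are absorbed on the two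
   sides. *)
pose p2 := rf_comp (rf_map iF v1) P2; pose h2 := rf_comp H2 (rf_map iF v2).
have nh2 : nonconst h2.
  move: ngv2; rewrite -(nonconst_map iF) rf_map_comp // P2E rf_compA //.
  exact: nonconst_compr.
have dec : rf_map iF f = rf_comp p2 h2.
  by rewrite fE !rf_map_comp // P2E [rf_comp (rf_comp P2 _) _]rf_compA // -rf_compA.
(* Since $h \circ u_2 = v \circ s \circ H_2$, composing with $v_2$ shows that $v \circ s$ takes [h2]
   to [h]. *)
exists p2, h2; split=> //; exists (rf_comp v s), (rf_comp t w).
have inv : comp_inverse (rf_comp v s) (rf_comp t w) by exact: comp_inverse_comp.
have nH2O : nonconst (rf_map jF H2) by rewrite nonconst_map.
have nh2O : nonconst (rf_map jF h2) by rewrite nonconst_map.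
have nv2O : nonconst (lift v2) by rewrite !nonconst_map.
have h2OE : rf_map jF h2 = rf_comp (rf_map jF H2) (lift v2).
  by rewrite /h2 rf_map_comp.
have hE : rf_map jK' h = rf_comp (rf_comp v s) (rf_map jF h2).
  rewrite rf_compA // h2OE -[rf_comp s _]rf_compA // -ABE -rf_compA // vAB.
  rewrite rf_compA // -lift_comp // uv2 /lift !rf_map_polyE !map_polyX.
  by rewrite rf_comp_X.
split=> //; first exact: unit_comp.
(* The outer functions are compared after composing with [h]: both sides become [f], because $t
   \circ w$ takes [h] back to [h2]. *)
apply: (rf_comp_inj nhO); rewrite -lift_f rf_compA // hE.
rewrite -[rf_comp (rf_comp t w) _]rf_compA //.
by case: inv => _ ->; rewrite rf_compX -rf_map_comp // -dec.
Qed.
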